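(* Let $p>3$ be a prime and $t\in\mathbb Z_p$ with $t\not\equiv0\pmod p$. Then $$\sum_{k=0}^{p-1}\binom{-\frac1{12}}k\binom{-\frac5{12}}k(1-t)^k\equiv t^{\langle -\frac1{12}\rangle_p}\sum_{k=0}^{p-1}\binom{-\frac1{12}}k\binom{-\frac7{12}}k\Big(1-\frac1t\Big)^k\equiv\begin{cases}P_{[\frac p6]}(\sqrt t)\pmod p&\text{if }p\equiv1\pmod4,\\ \big(\frac tp\big)P_{[\frac p6]}(\sqrt t)\sqrt t\pmod p&\text{if }p\equiv3\pmod4.\end{cases}$$
   Context: $\mathbb Z_p$ is the set of rationals with denominator coprime to $p$; congruences mod $p$ are in $\mathbb Z_p$. For $a\in\mathbb Z_p$, $\langle a\rangle_p\in\{0,\dots,p-1\}$ with $a\equiv\langle a\rangle_p\pmod p$. $[x]$ is the floor. For rational $a$, $\binom ak=a(a-1)\cdots(a-k+1)/k!$. $\big(\frac tp\big)$ is the Legendre symbol. $P_n$ is the Legendre polynomial ($P_0=1,P_1=x,(n+1)P_{n+1}=(2n+1)xP_n-nP_{n-1}$). Here $[p/6]$ is even when $p\equiv1\pmod4$ and odd when $p\equiv3\pmod 4$, so both $P_{[p/6]}(\sqrt t)$ resp. $P_{[p/6]}(\sqrt t)\sqrt t$ are polynomials in $t$, evaluated at $t$. *)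

(* Defs.v *)
From mathcomp Require Import all_boot all_order all_algebra.

Set Implicit Arguments.
Unset Strict Implicit.
Unset Printing Implicit Defensive.

Import Order.TTheory GRing.Theory Num.Theory.
Local Open Scope ring_scope.

Definition Zp_int (p : nat) (a : rat) : bool := coprime p `|denq a|%N.

(* Congruence in the ring Z_p: it asserts in particular that both sides lie
   in Z_p. *)
Definition Zp_congr (p : nat) (a b : rat) : bool :=
  [&& Zp_int p a, Zp_int p b & Zp_int p ((a - b) / p%:R)].

(* For p prime and a in Z_p there is exactly one such i; the value 0 in the
   other branch is never used. *)
Definition Zp_residue (p : nat) (a : rat) : nat :=
  if [pick i : 'I_p | Zp_congr p a i%:R] is Some i then i : nat else 0%N.

Definition Zp_legendre_symbol (p : nat) (a : rat) : rat :=
  if Zp_congr p a 0 then 0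
  else if [exists x : 'I_p, Zp_congr p (x%:R ^+ 2) a] then 1 else -1.

Definition gbinom (a : rat) (k : nat) : rat :=
  (\prod_(i < k) (a - i%:R)) / k`!%:R.

(* The recurrence (n+1) P_(n+1) = (2n+1) X P_n - n P_(n-1), with n = m+1. *)
Fixpoint legendre (n : nat) : {poly rat} :=
  match n with
  | 0%N => 1
  | n'.+1 =>
      match n' with
      | 0%N => 'X
      | m.+1 =>
          m.+2%:R^-1 *: ((2 * m.+1 + 1)%:R *: ('X * legendre n')
                         - m.+1%:R *: legendre m)
      end
  end.

(* For a polynomial Q having only monomials of even degree, Q(sqrt x) is a
   polynomial in x, namely [even_poly Q], whose i-th coefficient is the
   coefficient of degree 2i of Q.  [eval_sqrt Q t] is its value at t; see
   [eval_sqrtE].  It is meaningful only if [odd_poly Q = 0]. *)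
Definition eval_sqrt (Q : {poly rat}) (t : rat) : rat := (even_poly Q).[t].

Lemma eval_sqrtE (L : fieldType) (f : {rmorphism rat -> L})
    (Q : {poly rat}) (t : rat) (s : L) :
  odd_poly Q = 0 -> s ^+ 2 = f t -> (map_poly f Q).[s] = f (eval_sqrt Q t).
Proof.
move=> Q0 st; rewrite -{1}(poly_even_odd Q) Q0 comp_poly0 mul0r addr0.
by rewrite map_comp_poly map_polyXn horner_comp hornerXn st horner_map.
Qed.

Lemma even_poly_mulX (Q : {poly rat}) : even_poly ('X * Q) = odd_poly Q * 'X.
Proof. by rewrite mulrC even_polyMX. Qed.

Lemma odd_poly_mulX (Q : {poly rat}) : odd_poly ('X * Q) = even_poly Q.
Proof. by rewrite mulrC odd_polyMX. Qed.

Lemma legendre_parity n :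
  (if odd n then even_poly (legendre n) else odd_poly (legendre n)) = 0.
Proof.
suff [] : (if odd n then even_poly (legendre n) else odd_poly (legendre n)) = 0
  /\ (if odd n.+1 then even_poly (legendre n.+1)
      else odd_poly (legendre n.+1)) = 0 by [].
elim: n => [|n [IH1 IH2]].
  split; first exact: odd_polyC.
  by apply/polyP => i; rewrite /= coef_even_poly coefX coef0; case: i.
split=> //.
have -> : legendre n.+2 =
  n.+2%:R^-1 *: ((2 * n.+1 + 1)%:R *: ('X * legendre n.+1)
                 - n.+1%:R *: legendre n) by [].
move: IH1 IH2; rewrite [odd n.+2]/= negbK [odd n.+1]/=.
case: (odd n) => /= IH1 IH2.
  rewrite even_polyZ even_polyD -scaleNr !even_polyZ IH1 even_poly_mulX.
  by rewrite IH2 mul0r !scaler0 addr0 scaler0.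
rewrite odd_polyZ odd_polyD -scaleNr !odd_polyZ IH1 odd_poly_mulX.
by rewrite IH2 !scaler0 addr0 scaler0.
Qed.

Lemma legendre_even n : ~~ odd n -> odd_poly (legendre n) = 0.
Proof. by move=> /negbTE n_even; have := legendre_parity n; rewrite n_even. Qed.

Lemma legendre_odd_mulX n : odd n -> odd_poly (legendre n * 'X) = 0.
Proof.
by move=> n_odd; rewrite odd_polyMX; have := legendre_parity n; rewrite n_odd.
Qed.

(* Main.v *)
(** A sum over k < p depends only on its parameters modulo p, so a parameter
    in Z_p may be replaced by its least residue m, which truncates the sum at
    k = m.  For such a natural number m, Pfaff's transformation
      2F1(-m, -b; 1; 1-t) = t^m 2F1(-m, 1+b; 1; 1-1/t)
    is an identity over the rationals; this is the first congruence.  The even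
    and odd parts of the Legendre polynomials are
      P_2j(x) = 2F1(-j, j+1/2; 1; 1-x^2),
      P_(2j+1)(x) = x 2F1(-j, j+3/2; 1; 1-x^2),
    which settles p = 1 (mod 4), one of -1/12, -5/12 having residue [p/12].
    If p = 3 (mod 4), a second Pfaff transformation, through the residue of
    -7/12, leaves the factor t^((p+1)/2), and Euler's criterion applies. *)
Require Import Defs.
From mathcomp Require Import all_boot all_order all_algebra.
From mathcomp Require Import all_fingroup all_solvable all_field.
From mathcomp Require Import ring lra zify.
Import GRing.Theory Num.Theory.
Set Implicit Arguments.
Unset Strict Implicit.
Unset Printing Implicit Defensive.
Local Open Scope ring_scope.

(** * Generalized binomial coefficients over the rationals *)

Lemma gbinom0 a : gbinom a 0 = 1.
Proof. by rewrite /gbinom big_ord0 fact0 divr1. Qed.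

Lemma natr_rat_neq0 n : n.+1%:R != 0 :> rat.
Proof. by rewrite pnatr_eq0. Qed.

Lemma gbinomSr a k : gbinom a k.+1 = gbinom a k * (a - k%:R) / k.+1%:R.
Proof.
rewrite /gbinom big_ord_recr /= factS natrM.
have h1 := natr_rat_neq0 k; have h2 : k`!%:R != 0 :> rat.
  by rewrite pnatr_eq0 -lt0n fact_gt0.
by rewrite -natr1 in h1 *; field; rewrite ?h1 ?h2.
Qed.

Lemma gbinomSS a k : gbinom (a + 1) k.+1 = gbinom a k * (a + 1) / k.+1%:R.
Proof.
elim: k => [|k IH]; first by rewrite gbinomSr !gbinom0 subr0.
rewrite gbinomSr IH gbinomSr.
have h1 := natr_rat_neq0 k; have h2 := natr_rat_neq0 k.+1.
by rewrite -!natr1 in h1 h2 *; field; rewrite ?h1 ?h2.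
Qed.

Lemma gbinom_pascal a k :
  gbinom (a + 1) k.+1 = gbinom a k + gbinom a k.+1.
Proof.
rewrite gbinomSS gbinomSr; have h1 := natr_rat_neq0 k.
by rewrite -natr1 in h1 *; field.
Qed.

Lemma gbinom_nat m k : gbinom m%:R k = 'C(m, k)%:R.
Proof.
elim: m k => [|m IH] [|k]; rewrite ?gbinom0 ?bin0 //.
  by rewrite /gbinom big_ord_recl /= subrr mul0r mul0r.
by rewrite -natr1 gbinom_pascal !IH binS natrD addrC.
Qed.

(** Upper negation; it produces the parameter [- 1 - b] of Pfaff's transformation. *)
Lemma gbinomN b k : gbinom (- 1 - b) k = (-1) ^+ k * gbinom (b + k%:R) k.
Proof.
elim: k => [|k IH]; first by rewrite !gbinom0 expr0 mulr1.
rewrite gbinomSr IH -natr1 addrA gbinomSS exprS.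
have h1 := natr_rat_neq0 k.
by rewrite -natr1 in h1 *; field.
Qed.

(** * Truncated hypergeometric sums and Pfaff's transformation *)

(** Since [gbinom a k] is (-1)^k (-a)_k / k!, this is 2F1(-a, -b; 1; z) cut to its first [N]
    terms. *)
Definition gbinom_sum (N : nat) (a b z : rat) : rat :=
  \sum_(0 <= k < N) gbinom a k * gbinom b k * z ^+ k.

Lemma gbinom_sumC N a b z : gbinom_sum N a b z = gbinom_sum N b a z.
Proof. by apply: eq_bigr => k _; rewrite (mulrC (gbinom a k)). Qed.

Lemma gbinom_sumS N a b z :
  gbinom_sum N.+1 a b z = gbinom_sum N a b z + gbinom a N * gbinom b N * z ^+ N.
Proof. by rewrite /gbinom_sum big_nat_recr. Qed.

Lemma gbinom_sum_bin N m b z : (m < N)%N ->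
  gbinom_sum N m%:R b z =
  \sum_(0 <= k < m.+1) 'C(m, k)%:R * (gbinom b k * z ^+ k).
Proof.
move=> ltmN; rewrite /gbinom_sum (big_cat_nat _ (n := m.+1)) //=.
rewrite [X in _ + X]big_nat_cond [X in _ + X]big1 ?addr0.
  by apply: eq_bigr => k _; rewrite gbinom_nat mulrA.
move=> k /andP[/andP[ltmk _] _].
by rewrite gbinom_nat bin_small // !mul0r.
Qed.

(** Pascal's rule under the sum; it drives the induction in [pfaff_binomial]. *)
Lemma sum_binS (F : nat -> rat) m :
  \sum_(0 <= k < m.+2) 'C(m.+1, k)%:R * F k =
  \sum_(0 <= k < m.+1) 'C(m, k)%:R * F k +
  \sum_(0 <= k < m.+1) 'C(m, k)%:R * F k.+1.
Proof.
rewrite big_nat_recl // bin0.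
under eq_bigr => k _ do rewrite binS natrD mulrDl.
rewrite big_split /= addrA; congr (_ + _).
rewrite big_nat_recr //= bin_small // mul0r addr0.
by rewrite [in RHS]big_nat_recl // bin0.
Qed.

(* The shift by [r] makes induction on [m] possible: by Pascal's rule both sides
   F(m, r, b) satisfy F(m+1, r, b) = t F(m, r, b) + (1-t) F(m, r+1, b+1). *)
Lemma pfaff_binomial m r (b t : rat) : t != 0 ->
  \sum_(0 <= k < m.+1) 'C(m, k)%:R * (gbinom b (k + r) * (1 - t) ^+ k) =
  t ^+ m * \sum_(0 <= k < m.+1)
    'C(m, k)%:R * (gbinom (b + k%:R) (k + r) * ((1 - t) / t) ^+ k).
Proof.
move=> t0; elim: m r b => [|m IH] r b.
  by rewrite !big_nat1 !expr0 !addr0 mul1r.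
have pull (c g x y : rat) : c * (g * (x * y)) = x * (c * (g * y)) by ring.
rewrite !sum_binS mulrDr exprSr -!mulrA.
under [X in _ = _ + _ * (_ * X)]eq_bigr => k _ do
  rewrite exprS addSnnS -natr1 (addrC k%:R) addrA pull.
under [X in _ + X = _]eq_bigr => k _ do
  rewrite exprS addSnnS pull.
rewrite -!mulr_sumr [X in _ = X + _]mulrCA -IH.
have -> : t ^+ m * (t * ((1 - t) / t * \sum_(0 <= i < m.+1) 'C(m, i)%:R *
    (gbinom (b + 1 + i%:R) (i + r.+1) * ((1 - t) / t) ^+ i))) =
  (1 - t) * (t ^+ m * \sum_(0 <= i < m.+1) 'C(m, i)%:R *
    (gbinom (b + 1 + i%:R) (i + r.+1) * ((1 - t) / t) ^+ i)) by field.
rewrite -IH.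
(* With L(r, b) the left-hand side at [m], the right-hand side is now t L(r, b) + (1-t) L(r+1, b+1),
   and Pascal's rule gives L(r+1, b+1) = L(r, b) + L(r+1, b). *)
under [X in _ = _ + _ * X]eq_bigr => k _ do
  rewrite addnS gbinom_pascal mulrDl mulrDr.
rewrite big_split /=.
under [X in _ = _ + _ * (_ + X)]eq_bigr => k _ do rewrite -addnS.
by ring.
Qed.

Lemma pfaff N m (b t : rat) : t != 0 -> (m < N)%N ->
  gbinom_sum N m%:R b (1 - t) =
  t ^+ m * gbinom_sum N m%:R (- 1 - b) (1 - 1 / t).
Proof.
move=> t0 ltmN; rewrite !gbinom_sum_bin //.
have := pfaff_binomial m 0 b t0.
under eq_bigr => k _ do rewrite addn0.
move=> ->; congr (_ * _); apply: eq_bigr => k _; rewrite addn0 gbinomN.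
(* The sign from [gbinomN] is absorbed in the power: -(1 - 1/t) = (1 - t)/t. *)
congr (_ * _); rewrite [RHS]mulrAC -exprMn [RHS]mulrC; congr (_ * _ ^+ _).
by field.
Qed.

(** * Legendre polynomials as terminating hypergeometric sums *)

(* The last term is the boundary term of a telescoping sum; it vanishes when [j]
   is a natural number less than [N]. *)
Lemma gbinom_sum_even_step N (j z : rat) :
  (2 * j + 2) * gbinom_sum N.+1 (j + 1) (- (j + 1) - 1 / 2) z =
  (4 * j + 3) * (1 - z) * gbinom_sum N.+1 j (- j - 3 / 2) z
  - (2 * j + 1) * gbinom_sum N.+1 j (- j - 1 / 2) z
  + (4 * j + 3) * gbinom j N * gbinom (- j - 3 / 2) N * z ^+ N.+1.
Proof.
(* All second parameters are written through [- j - 3 / 2], so that each new term reduces to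
   [gbinom j N] and [gbinom (- j - 3 / 2) N]. *)
have -> : - (j + 1) - 1 / 2 = - j - 3 / 2 :> rat by lra.
have -> : - j - 1 / 2 = - j - 3 / 2 + 1 :> rat by lra.
elim: N => [|N IH].
  rewrite /gbinom_sum !big_nat1 !gbinom0 expr0 expr1; lra.
rewrite ![gbinom_sum N.+2 _ _ _]gbinom_sumS mulrDr IH.
rewrite !gbinom_pascal !exprS !gbinomSr.
have h := natr_rat_neq0 N.
by rewrite -!natr1 in h *; field.
Qed.

(** This is the Legendre recurrence for P_(2j+3) divided by x. No factor 1 - z remains, so it holds
    term by term and has no boundary term. *)
Lemma gbinom_sum_odd_step N (j z : rat) :
  (2 * j + 3) * gbinom_sum N.+1 (j + 1) (- (j + 1) - 3 / 2) z =
  (4 * j + 5) * gbinom_sum N.+1 (j + 1) (- (j + 1) - 1 / 2) z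
  - (2 * j + 2) * gbinom_sum N.+1 j (- j - 3 / 2) z.
Proof.
rewrite /gbinom_sum !mulr_sumr -sumrB; apply: eq_bigr => k _.
have -> : - (j + 1) - 3 / 2 = - j - 5 / 2 :> rat by lra.
have -> : - (j + 1) - 1 / 2 = - j - 5 / 2 + 1 :> rat by lra.
have -> : - j - 3 / 2 = - j - 5 / 2 + 1 :> rat by lra.
case: k => [|k]; first by rewrite !gbinom0 expr0; lra.
rewrite !gbinom_pascal !exprS !gbinomSr.
have h := natr_rat_neq0 k.
by rewrite -!natr1 in h *; field.
Qed.

Lemma legendreSS n :
  legendre n.+2 = n.+2%:R^-1 *:
    ((2 * n.+1 + 1)%:R *: ('X * legendre n.+1) - n.+1%:R *: legendre n).
Proof. by []. Qed.

Lemma even_legendreSS n (t : rat) :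
  n.+2%:R * (even_poly (legendre n.+2)).[t] =
  (2 * n.+1 + 1)%:R * ((odd_poly (legendre n.+1)).[t] * t)
  - n.+1%:R * (even_poly (legendre n)).[t].
Proof.
rewrite legendreSS even_polyZ even_polyD -scaleNr !even_polyZ even_poly_mulX.
by rewrite !(hornerZ, hornerD, hornerM, hornerX) mulNr mulVKf // pnatr_eq0.
Qed.

Lemma odd_legendreSS n (t : rat) :
  n.+2%:R * (odd_poly (legendre n.+2)).[t] =
  (2 * n.+1 + 1)%:R * (even_poly (legendre n.+1)).[t]
  - n.+1%:R * (odd_poly (legendre n)).[t].
Proof.
rewrite legendreSS odd_polyZ odd_polyD -scaleNr !odd_polyZ odd_poly_mulX.
by rewrite !(hornerZ, hornerD, hornerM, hornerX) mulNr mulVKf // pnatr_eq0.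
Qed.

(** Both parities go through one induction: P_(2j+2) comes from P_2j and P_(2j+1), then P_(2j+3)
    from P_(2j+1) and the new P_(2j+2). *)
Lemma legendre_gbinom_sum N j (t : rat) : (j < N)%N ->
  (even_poly (legendre j.*2)).[t] =
    gbinom_sum N j%:R (- j%:R - 1 / 2) (1 - t) /\
  (odd_poly (legendre j.*2.+1)).[t] =
    gbinom_sum N j%:R (- j%:R - 3 / 2) (1 - t).
Proof.
case: N => // N; elim: j => [|j IH] ltjN.
  have gs0 b : gbinom_sum N.+1 0 b (1 - t) = 1.
    by rewrite (gbinom_sum_bin (m := 0)) // big_nat1 bin0 gbinom0 expr0 !mulr1.
  rewrite !gs0 [legendre _]/=; split.
    by rewrite even_polyC hornerC.
  rewrite [X in odd_poly X](_ : _ = 1 * 'X) ?mul1r //.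
  by rewrite -['X]mul1r odd_polyMX even_polyC hornerC.
have [|IHe IHo] := IH; first exact: ltnW.
have E : (even_poly (legendre j.+1.*2)).[t] =
    gbinom_sum N.+1 j.+1%:R (- j.+1%:R - 1 / 2) (1 - t).
  have h : j.*2.+2%:R != 0 :> rat by rewrite pnatr_eq0.
  apply: (mulfI h); rewrite even_legendreSS IHe IHo.
  have -> : j.*2.+2%:R = 2 * j%:R + 2 :> rat.
    by rewrite -!natr1 -mul2n natrM; ring.
  (* The boundary term contains 'C(j, N), which is 0 because j < N. *)
  rewrite -[j.+1%:R]natr1 gbinom_sum_even_step gbinom_nat bin_small //.
  by rewrite natrD natrM -!natr1 -mul2n natrM; ring.
split=> //.
have h : j.*2.+3%:R != 0 :> rat by rewrite pnatr_eq0.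
apply: (mulfI h); rewrite odd_legendreSS E IHo.
have -> : j.*2.+3%:R = 2 * j%:R + 3 :> rat.
  by rewrite -!natr1 -mul2n natrM; ring.
rewrite -[j.+1%:R]natr1 gbinom_sum_odd_step.
by rewrite natrD natrM -!natr1 -mul2n natrM; ring.
Qed.

(** * Arithmetic in Z_p and comparison with ['F_p] *)

(** Any denominator prime to [p] will do, reduced or not; closure under sums and products then needs
    no reduction of fractions. *)
Lemma Zp_intP p a :
  reflect (exists2 d, coprime p d & a * d%:R \is a Num.int) (Zp_int p a).
Proof.
apply: (iffP idP) => [pa | [d pd /intrP[n an]]].
  exists `|denq a|%N => //.
  by rewrite -[_%:R]/((`|denq a|%N : int)%:~R) absz_denq -numqE intr_int.
apply: coprime_dvdr pd.
suff: (`|denq a| %| `|(numq a * d%:Z)%R|)%N.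
  by rewrite abszM Gauss_dvdr // coprime_sym coprime_num_den.
apply/dvdnP; exists `|n|%N; rewrite -abszM; congr `|_|%N.
apply: (@intr_inj rat); rewrite !rmorphM /= -an numqE -!pmulrn.
by rewrite mulrAC.
Qed.

Lemma Zp_intz p (n : int) : Zp_int p n%:~R.
Proof. by apply/Zp_intP; exists 1%N; rewrite ?coprimen1 // mulr1 intr_int. Qed.

Lemma Zp_intn p n : Zp_int p n%:R.
Proof. exact: (Zp_intz p n). Qed.

Lemma Zp_intV p n : coprime p n -> Zp_int p n%:R^-1.
Proof.
move=> pn; apply/Zp_intP; exists n => //.
by have [->|n0] := eqVneq (n%:R : rat) 0; rewrite ?mulr0 ?mulVf // rpred1.
Qed.

Lemma Zp_intN p a : Zp_int p a -> Zp_int p (- a).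
Proof.
by case/Zp_intP=> d pd ad; apply/Zp_intP; exists d; rewrite // mulNr rpredN.
Qed.

Lemma Zp_intD p a b : Zp_int p a -> Zp_int p b -> Zp_int p (a + b).
Proof.
case/Zp_intP=> d pd ad /Zp_intP[e pe be]; apply/Zp_intP; exists (d * e)%N.
  by rewrite coprimeMr pd.
by rewrite natrM mulrDl mulrA [b * _]mulrCA rpredD // rpredM // natr_int.
Qed.

Lemma Zp_intM p a b : Zp_int p a -> Zp_int p b -> Zp_int p (a * b).
Proof.
case/Zp_intP=> d pd ad /Zp_intP[e pe be]; apply/Zp_intP; exists (d * e)%N.
  by rewrite coprimeMr pd.
by rewrite natrM mulrACA rpredM.
Qed.

Lemma Zp_intB p a b : Zp_int p a -> Zp_int p b -> Zp_int p (a - b).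
Proof. by move=> pa pb; exact: (Zp_intD pa (Zp_intN pb)). Qed.

Lemma Zp_congr_intl p a b : Zp_congr p a b -> Zp_int p a.
Proof. by case/and3P. Qed.

Lemma Zp_congr_refl p a : Zp_int p a -> Zp_congr p a a.
Proof. by move=> pa; rewrite /Zp_congr pa subrr mul0r (Zp_intn p 0). Qed.

Lemma Zp_congr_sym p a b : Zp_congr p a b -> Zp_congr p b a.
Proof.
case/and3P=> pa pb pab; apply/and3P; split=> //.
by rewrite -opprB mulNr Zp_intN.
Qed.

Lemma Zp_congr_trans p b a c :
  Zp_congr p a b -> Zp_congr p b c -> Zp_congr p a c.
Proof.
case/and3P=> pa pb pab /and3P[_ pc pbc]; apply/and3P; split=> //.
by rewrite -(subrK b a) -addrA mulrDl Zp_intD.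
Qed.

Lemma Zp_congrD p a a' b b' :
  Zp_congr p a a' -> Zp_congr p b b' -> Zp_congr p (a + b) (a' + b').
Proof.
case/and3P=> pa pa' paa /and3P[pb pb' pbb].
apply/and3P; split; try exact: Zp_intD.
by rewrite opprD addrACA mulrDl Zp_intD.
Qed.

Lemma Zp_congrM p a a' b b' :
  Zp_congr p a a' -> Zp_congr p b b' -> Zp_congr p (a * b) (a' * b').
Proof.
case/and3P=> pa pa' paa /and3P[pb pb' pbb].
apply/and3P; split; try exact: Zp_intM.
have -> : (a * b - a' * b') / p%:R =
    a * ((b - b') / p%:R) + (a - a') / p%:R * b'.
  by ring.
by apply: Zp_intD; apply: Zp_intM.
Qed.

Lemma Zp_congrX p a b n : Zp_congr p a b -> Zp_congr p (a ^+ n) (b ^+ n).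
Proof.
move=> pab; elim: n => [|n IH].
  by rewrite !expr0 (Zp_congr_refl (Zp_intn p 1)).
by rewrite !exprS Zp_congrM.
Qed.

Lemma Zp_congr_sum p m n (F G : nat -> rat) :
  (forall k, (m <= k < n)%N -> Zp_congr p (F k) (G k)) ->
  Zp_congr p (\sum_(m <= k < n) F k) (\sum_(m <= k < n) G k).
Proof.
move=> FG; rewrite big_nat [X in Zp_congr _ _ X]big_nat.
apply: (big_ind2 (Zp_congr p)) => //.
  exact: (Zp_congr_refl (Zp_intn p 0)).
by move=> *; apply: Zp_congrD.
Qed.

(** Transfers integer congruences to a field, where Fermat's theorem and Euler's criterion apply;
    rationals get there through [Zp_congr_nat_rep]. *)
Lemma Zp_congr_Fp p (m n : int) : prime p ->
  Zp_congr p m%:~R n%:~R = (m%:~R == n%:~R :> 'F_p).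
Proof.
move=> p_pr; have p0 : p%:R != 0 :> rat by rewrite pnatr_eq0 -lt0n prime_gt0.
rewrite /Zp_congr !Zp_intz /= -subr_eq0 -!rmorphB /=.
move: (m - n) => {m n} k.
have pkE : (k%:~R == 0 :> 'F_p) = (p %| `|k|)%N.
  by rewrite (dvdn_pcharf (pchar_Fp p_pr)) {1}[k]intEsign rmorphM /= mulf_eq0
    rmorph_sign signr_eq0.
rewrite pkE; apply/Zp_intP/idP => [[d pd /intrP[e kde]] | ].
  rewrite -(Gauss_dvdl _ pd); apply/dvdnP; exists `|e|%N.
  rewrite -[d]/`|d%:Z|%N -abszM -[p in RHS]/`|p%:Z|%N -abszM; congr `|_|%N.
  apply: (@intr_inj rat); rewrite !rmorphM /= -kde -!pmulrn.
  by field.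
move/dvdnP=> [e ke]; exists 1%N; rewrite ?coprimen1 // mulr1 [k]intEsign ke.
by rewrite !rmorphM /= mulrA mulfK // rpredM ?intr_int.
Qed.

Lemma Zp_congr_nat_rep p a : prime p -> Zp_int p a ->
  exists i : 'I_p, Zp_congr p a i%:R.
Proof.
move=> p_pr /[dup] pa /Zp_intP[d pd /intrP[n adn]].
have p0 : p%:R != 0 :> rat by rewrite pnatr_eq0 -lt0n prime_gt0.
have d0 : (d%:R : 'F_p) != 0.
  by rewrite -(dvdn_pcharf (pchar_Fp p_pr)) -prime_coprime.
(* The representative of a = n/d is the quotient n/d computed in ['F_p]. *)
have [x nxd] : exists x : 'F_p, n%:~R = x * d%:R.
  by exists (n%:~R / d%:R); rewrite divfK.
have ltx : (x < p)%N by rewrite -[X in (_ < X)%N](Fp_cast p_pr).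
exists (Ordinal ltx) => /=.
have {}nxd : Zp_congr p n%:~R (x * d)%N%:~R.
  by rewrite Zp_congr_Fp // nxd -pmulrn natrM natr_Zp.
have dV : d%:R / d%:R = 1 :> rat.
  rewrite divff // pnatr_eq0; apply: contraTneq pd => ->.
  by rewrite prime_coprime // dvdn0.
have := Zp_congrM nxd (Zp_congr_refl (Zp_intV pd)).
by rewrite -adn -pmulrn natrM -!mulrA dV !mulr1.
Qed.

(** * Euler's criterion, least residues and inverses *)

(** The unit group is cyclic of order 2h. If x = g^k for a generator g, then x^h = 1 forces 2h to
    divide kh, so k is even and y = g^(k/2). *)
Lemma finField_euler (F : finFieldType) (x : F) : odd #|F| -> x != 0 ->
  x ^+ #|F|.-1./2 = 1 -> exists y, x = y ^+ 2.
Proof.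
move=> oddF x0 xh; set h := (_./2) in xh.
have /cyclicP[g Gg] := field_unit_group_cyclic [set: {unit F}]%G.
have ux : x \is a GRing.unit by rewrite unitfE.
have /cycleP[k uxk] : FinRing.unit F ux \in <[g]>%g by rewrite -Gg inE.
have og : #[g]%g = h.*2.
  rewrite /order -Gg card_finField_unit /h.
  have := finRing_gt1 F; case: #|F| oddF => // n; rewrite /= => evn _.
  by rewrite even_halfK.
have h0 : (0 < h)%N by rewrite -double_gt0 -og order_gt0.
have : (g ^+ (k * h) = 1)%g.
  rewrite expgM -uxk; apply: val_inj.
  by rewrite FinRing.val_unitX xh.
move/eqP; rewrite -order_dvdn og -mul2n dvdn_pmul2r // dvdn2 => evk.
exists (val g ^+ k./2); rewrite -exprM muln2 even_halfK //.
by rewrite -[x]/(val (FinRing.unit F ux)) uxk FinRing.val_unitX.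
Qed.

Lemma Zp_congrB p a a' b b' :
  Zp_congr p a a' -> Zp_congr p b b' -> Zp_congr p (a - b) (a' - b').
Proof.
move=> paa pbb; apply: Zp_congrD => //; rewrite -mulN1r -[- b']mulN1r.
exact: Zp_congrM (Zp_congr_refl (Zp_intN (Zp_intn p 1))) pbb.
Qed.

Lemma Zp_congr_nat_Fp p m n : prime p ->
  Zp_congr p m%:R n%:R = (m%:R == n%:R :> 'F_p).
Proof. by move=> p_pr; exact: (Zp_congr_Fp m n p_pr). Qed.

Lemma Zp_residueP p a : prime p -> Zp_int p a ->
  (Zp_residue p a < p)%N /\ Zp_congr p a (Zp_residue p a)%:R.
Proof.
move=> p_pr pa; rewrite /Zp_residue; case: pickP => [i // | no].
by case: (Zp_congr_nat_rep p_pr pa) => i; rewrite no.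
Qed.

Lemma Zp_residue_unique p a i : prime p -> (i < p)%N ->
  Zp_congr p a i%:R -> Zp_residue p a = i.
Proof.
move=> p_pr ltip pai; have [ltrp par] := Zp_residueP p_pr (Zp_congr_intl pai).
have := Zp_congr_trans (Zp_congr_sym par) pai.
rewrite Zp_congr_nat_Fp // => /eqP /(congr1 (@nat_of_ord _)).
by rewrite !val_Fp_nat // !modn_small.
Qed.

(** If t = n/d is not 0 modulo [p], its numerator n is prime to [p] and serves as a denominator of
    1/t. *)
Lemma Zp_int_inv p t : prime p -> Zp_int p t -> ~~ Zp_congr p t 0 ->
  Zp_int p t^-1.
Proof.
move=> p_pr pt; have /Zp_intP[d pd /intrP[n tdn]] := pt.
have p0 : p%:R != 0 :> rat by rewrite pnatr_eq0 -lt0n prime_gt0.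
have d0 : d%:R != 0 :> rat.
  rewrite pnatr_eq0; apply: contraTneq pd => ->.
  by rewrite prime_coprime // dvdn0.
move=> tn0; have pn : coprime p `|n|%N.
  rewrite prime_coprime //; apply: contra tn0 => /dvdnP[e ne].
  rewrite /Zp_congr pt (Zp_intn p 0) subr0 /=.
  rewrite -[t](mulfK d0) tdn [n]intEsign ne rmorphM /= -pmulrn natrM.
  have -> : ((-1) ^+ (n < 0)%R)%:~R * (e%:R * p%:R) / d%:R / p%:R =
     ((-1) ^+ (n < 0)%R)%:~R * (e%:R / d%:R) :> rat by field; rewrite d0.
  by rewrite Zp_intM ?Zp_intz // Zp_intM ?Zp_intn ?Zp_intV.
have [->|t0] := eqVneq t 0; first by rewrite invr0 (Zp_intn p 0).
apply/Zp_intP; exists `|n|%N => //.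
have -> : `|n|%N%:R = (-1) ^+ (n < 0)%R * (t * d%:R).
  by rewrite tdn pmulrn abszEsign rmorphM /= rmorph_sign.
by rewrite mulrCA mulKf // rpredM ?natr_int // rpredX.
Qed.

Lemma Zp_legendre_symbol_euler p t : prime p -> odd p -> Zp_int p t ->
  ~~ Zp_congr p t 0 ->
  Zp_congr p (t ^+ p.-1./2) (Zp_legendre_symbol p t).
Proof.
move=> p_pr odd_p pt t0; have [i pti] := Zp_congr_nat_rep p_pr pt.
set x : 'F_p := i%:R; set h := (_./2).
have hE : h.*2 = p.-1.
  by rewrite /h; case: (p) odd_p => // n /= evn; rewrite even_halfK.
have x0 : x != 0.
  apply: contra t0 => xi0; apply: Zp_congr_trans pti _.
  by rewrite (Zp_congr_nat_Fp i 0).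
have fermat (y : 'F_p) : y != 0 -> y ^+ h.*2 = 1.
  move=> y0; apply: (mulfI y0); rewrite -exprS hE prednK ?prime_gt0 // mulr1.
  by rewrite -[X in _ ^+ X](card_Fp p_pr) expf_card.
have sqrE (y : 'I_p) : Zp_congr p (y%:R ^+ 2) t = (y%:R ^+ 2 == x).
  rewrite -!natrX -Zp_congr_nat_Fp //.
  apply/idP/idP => yt; first exact: Zp_congr_trans pti.
  exact: Zp_congr_trans (Zp_congr_sym pti).
rewrite /Zp_legendre_symbol (negbTE t0).
apply: Zp_congr_trans (Zp_congrX h pti) _.
case: ifPn => [/existsP[y] | /existsPn nsq].
  rewrite sqrE => /eqP yx.
  rewrite -natrX (Zp_congr_nat_Fp _ 1) // natrX -/x -yx -exprM mul2n fermat //.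
  by apply: contra x0 => /eqP y0; rewrite -yx y0 expr0n.
rewrite -natrX -[-1]/((-1)%:~R) pmulrn Zp_congr_Fp //= -pmulrn natrX -/x.
(* By Fermat x^h is 1 or -1; the value 1 would make x a square, against [nsq]. *)
have : (x ^+ h) ^+ 2 == 1 by rewrite -exprM muln2 fermat.
rewrite sqrf_eq1 => /orP[/eqP xh1 | //].
have [|||y xy] := @finField_euler 'F_p x; rewrite ?card_Fp //.
have lty : (y < p)%N by rewrite -[X in (_ < X)%N](Fp_cast p_pr).
by have := nsq (Ordinal lty); rewrite sqrE /= natr_Zp xy eqxx.
Qed.

(** * Congruences between the truncated sums *)

(** For k < p the denominator k! is invertible modulo [p]. *)
Lemma gbinom_congr p a b k : prime p -> Zp_congr p a b -> (k < p)%N ->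
  Zp_congr p (gbinom a k) (gbinom b k).
Proof.
move=> p_pr pab; elim: k => [|k IH] ltkp.
  by rewrite !gbinom0 (Zp_congr_refl (Zp_intn p 1)).
rewrite !gbinomSr; apply: Zp_congrM; last first.
  apply/Zp_congr_refl/Zp_intV; rewrite prime_coprime //.
  by apply: contraL ltkp => /dvdn_leq; rewrite -leqNgt; apply.
apply: Zp_congrM; first by rewrite IH // ltnW.
exact: (Zp_congrB pab (Zp_congr_refl (Zp_intn p k))).
Qed.

Lemma gbinom_sum_congr p a a' b b' z z' : prime p -> Zp_congr p a a' ->
  Zp_congr p b b' -> Zp_congr p z z' ->
  Zp_congr p (gbinom_sum p a b z) (gbinom_sum p a' b' z').
Proof.
move=> p_pr paa pbb pzz; apply: Zp_congr_sum => k /andP[_ ltkp].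
apply: Zp_congrM (Zp_congrX k pzz).
by apply: Zp_congrM; apply: gbinom_congr.
Qed.

(** The difference of the two sides is -(n m + r)/n. This is how residues of fractions are computed
    below. *)
Lemma Zp_congr_fracN p n r m : prime p -> coprime p n -> (p %| n * m + r)%N ->
  Zp_congr p (- (r%:R / n%:R)) m%:R.
Proof.
move=> p_pr pn /dvdnP[c nmr].
have p0 : p%:R != 0 :> rat by rewrite pnatr_eq0 -lt0n prime_gt0.
have n0 : n%:R != 0 :> rat.
  rewrite pnatr_eq0; apply: contraTneq pn => ->.
  by rewrite prime_coprime // dvdn0.
have pV := Zp_intV pn.
apply/and3P; split; first by rewrite Zp_intN // Zp_intM ?Zp_intn.
  exact: Zp_intn.
have -> : (- (r%:R / n%:R) - m%:R) / p%:R = - (c%:R / n%:R) :> rat.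
  have : (n * m + r)%:R = (c * p)%:R :> rat by rewrite nmr.
  rewrite natrD !natrM => e.
  have -> : r%:R = c%:R * p%:R - n%:R * m%:R :> rat by rewrite -e; ring.
  by field; rewrite n0.
by rewrite Zp_intN // Zp_intM ?Zp_intn.
Qed.

(** Replace [a] by its residue, apply the exact identity [pfaff], and put [a] back. *)
Lemma pfaff_congr p a b t : prime p -> Zp_int p a -> Zp_int p b ->
  Zp_int p t -> ~~ Zp_congr p t 0 ->
  Zp_congr p (gbinom_sum p a b (1 - t))
    (t ^+ Zp_residue p a * gbinom_sum p a (- 1 - b) (1 - 1 / t)).
Proof.
move=> p_pr pa pb pt t0.
have [ltmp pam] := Zp_residueP p_pr pa.
have t_neq0 : t != 0.
  by apply: contraNneq t0 => ->; exact: Zp_congr_refl (Zp_intn p 0).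
have p1 := Zp_intn p 1.
have pu : Zp_int p (1 - 1 / t) by rewrite div1r Zp_intB ?Zp_int_inv.
have pm := gbinom_sum_congr p_pr pam.
have pt1 := Zp_congr_refl (Zp_intB p1 pt).
apply: (Zp_congr_trans (pm _ _ _ _ (Zp_congr_refl pb) pt1)).
rewrite pfaff //; apply: Zp_congrM.
  by apply/Zp_congrX/Zp_congr_refl.
apply/Zp_congr_sym/pm; apply: Zp_congr_refl => //.
exact: (Zp_intB (Zp_intN p1) pb).
Qed.

(** Fixing a + b makes b congruent to -j - 1/2. Either of -1/12 and -5/12 can thus play the role of
    [a]. *)
Lemma even_legendre_congr p a b j t : prime p -> (2 < p)%N -> (j < p)%N ->
  Zp_int p t -> a + b = - (1 / 2) -> Zp_congr p a j%:R ->
  Zp_congr p (gbinom_sum p a b (1 - t)) (even_poly (legendre j.*2)).[t].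
Proof.
move=> p_pr p2 ltjp pt ab paj; have [-> _] := legendre_gbinom_sum t ltjp.
have -> : b = - (1 / 2) - a by rewrite -ab; ring.
have -> : - j%:R - 1 / 2 = - (1 / 2) - j%:R :> rat by ring.
apply: gbinom_sum_congr => //; last first.
  exact/Zp_congr_refl/(Zp_intB (Zp_intn p 1) pt).
apply: Zp_congrB paj; apply/Zp_congr_refl/Zp_intN/Zp_intM.
  exact: (Zp_intn p 1).
by apply: (@Zp_intV p 2); rewrite prime_coprime // gtnNdvd.
Qed.

(** The odd analogue, meant for the pair -7/12, -11/12, whose sum is -3/2. *)
Lemma odd_legendre_congr p a b j t : prime p -> (2 < p)%N -> (j < p)%N ->
  Zp_int p t -> a + b = - (3 / 2) -> Zp_congr p a j%:R ->
  Zp_congr p (gbinom_sum p a b (1 - t)) (odd_poly (legendre j.*2.+1)).[t].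
Proof.
move=> p_pr p2 ltjp pt ab paj; have [_ ->] := legendre_gbinom_sum t ltjp.
have -> : b = - (3 / 2) - a by rewrite -ab; ring.
have -> : - j%:R - 3 / 2 = - (3 / 2) - j%:R :> rat by ring.
apply: gbinom_sum_congr => //; last first.
  exact/Zp_congr_refl/(Zp_intB (Zp_intn p 1) pt).
apply: Zp_congrB paj; apply/Zp_congr_refl/Zp_intN/Zp_intM.
  exact: (Zp_intn p 3).
by apply: (@Zp_intV p 2); rewrite prime_coprime // gtnNdvd.
Qed.

(** * Primes modulo 12, and the two cases of the theorem *)

Lemma coprime12 p : prime p -> (3 < p)%N -> coprime p 12.
Proof.
move=> p_pr p3; rewrite (coprimeMr p 4 3) (coprimeMr p 2 2).
rewrite ![coprime p _]coprime_sym !prime_coprime // !dvdn_prime2 //.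
by rewrite !neq_ltn p3 (ltn_trans _ p3).
Qed.

(** Here q is the residue of -1/12 if p = 12q + 1, and of -5/12 if p = 12q + 5. *)
Lemma mod4_1_coprime12 p : coprime p 12 -> p = 1 %[mod 4] ->
  exists q, [/\ (p %/ 6 = q.*2)%N, (q < p)%N &
    p = (12 * q + 1)%N \/ p = (12 * q + 5)%N].
Proof.
rewrite (coprimeMr p 4 3) => /andP[_].
rewrite coprime_sym prime_coprime // => p3 p4.
by exists (p %/ 12)%N; split; lia.
Qed.

(** Here q is the residue of -7/12 if p = 12q + 7, and of -11/12 if p = 12q + 11. *)
Lemma mod4_3_coprime12 p : coprime p 12 -> p = 3 %[mod 4] ->
  exists q, [/\ (p %/ 6 = q.*2.+1)%N, (q < p)%N &
    p = (12 * q + 7)%N \/ p = (12 * q + 11)%N].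
Proof.
rewrite (coprimeMr p 4 3) => /andP[_].
rewrite coprime_sym prime_coprime // => p3 p4.
by exists (p %/ 12)%N; split; lia.
Qed.

(** The fractions differ by 1/2, which is (p+1)/2 modulo [p]; the explicit residues show that no
    reduction by [p] occurs. *)
Lemma Zp_residue_sub p : prime p -> coprime p 12 -> p = 3 %[mod 4] ->
  Zp_residue p (- (1 / 12%:R)) =
  (Zp_residue p (- (7%:R / 12%:R)) + p.-1./2.+1)%N.
Proof.
move=> p_pr p12 p4; have res r m : (m < p)%N -> (p %| 12 * m + r)%N ->
    Zp_residue p (- (r%:R / 12%:R)) = m.
  by move=> ltmp /(Zp_congr_fracN p_pr p12); apply: Zp_residue_unique.
have [q [_ _ [pE|pE]]] := mod4_3_coprime12 p12 p4.
  (* The residue of -r/12 is (c p - r)/12, with c the solution of c p = r modulo 12 in the range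
     0..11; c is the witness of divisibility. *)
  rewrite (res 1%N (7 * q + 4)%N) ?(res 7 q); try by lia.
    by rewrite pE.
  by apply/dvdnP; exists 7; lia.
rewrite (res 1%N (11 * q + 10)%N) ?(res 7 (5 * q + 4)%N); try by lia.
  by apply/dvdnP; exists 5; lia.
by apply/dvdnP; exists 11; lia.
Qed.

(** Combines the prefactors of two Pfaff transformations, at t and at 1/t. With h = (p-1)/2, t^h is
    left for Euler's criterion and one t for the factor ['X]. *)
Lemma expr_mul_inv (t g : rat) j h : t != 0 ->
  t ^+ (j + h.+1) * ((1 / t) ^+ j * g) = t ^+ h * (g * t).
Proof.
move=> t_neq0; have tj0 : t ^+ j != 0 by rewrite expf_neq0.
by rewrite exprD exprS div1r exprVn; field.
Qed.

Theorem theorem3p1 (p : nat) (t : rat) :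
  prime p -> (3 < p)%N -> Zp_int p t -> ~~ Zp_congr p t 0 ->
  let S1 := \sum_(0 <= k < p)
    gbinom (- (1 / 12%:R)) k * gbinom (- (5%:R / 12%:R)) k * (1 - t) ^+ k in
  let S2 := t ^+ Zp_residue p (- (1 / 12%:R)) *
    \sum_(0 <= k < p)
      gbinom (- (1 / 12%:R)) k * gbinom (- (7%:R / 12%:R)) k *
      (1 - 1 / t) ^+ k in
  [/\ Zp_congr p S1 S2,
      p = 1 %[mod 4] ->
        Zp_congr p S2 (eval_sqrt (legendre (p %/ 6)) t)
    & p = 3 %[mod 4] ->
        Zp_congr p S2 (Zp_legendre_symbol p t *
                       eval_sqrt (legendre (p %/ 6) * 'X) t)].
Proof.
move=> p_pr p3 pt t0 S1 S2; rewrite /eval_sqrt.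
have p12 := coprime12 p_pr p3.
have t_neq0 : t != 0.
  by apply: contraNneq t0 => ->; exact: Zp_congr_refl (Zp_intn p 0).
have frac_int r : Zp_int p (- (r%:R / 12%:R)).
  by rewrite Zp_intN // Zp_intM ?Zp_intn ?Zp_intV.
have frac r m : (p %| 12 * m + r)%N -> Zp_congr p (- (r%:R / 12%:R)) m%:R.
  exact: Zp_congr_fracN.
have S12 : Zp_congr p S1 S2.
  have := pfaff_congr p_pr (frac_int 1) (frac_int 5) pt t0.
  by have -> : - 1 - - (5%:R / 12%:R) = - (7%:R / 12%:R) :> rat by lra.
split=> // p4.
  apply: Zp_congr_trans (Zp_congr_sym S12) _.
  have [q [-> ltqp [pE|pE]]] := mod4_1_coprime12 p12 p4.
    apply: even_legendre_congr; rewrite ?(ltnW p3) //.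
    by apply: (frac 1); rewrite -pE.
  rewrite [S1]gbinom_sumC.
  apply: even_legendre_congr; rewrite ?(ltnW p3) //.
  by apply: (frac 5); rewrite -pE.
have pu : Zp_int p (1 / t) by rewrite div1r Zp_int_inv.
have u0 : ~~ Zp_congr p (1 / t) 0.
  apply/negP => pu0; have := Zp_congrM (Zp_congr_refl pt) pu0.
  by rewrite div1r divff // mulr0 (Zp_congr_nat_Fp 1 0) // oner_eq0.
(* Pfaff at 1/t through -7/12 sends -1/12 to -11/12 and the argument 1 - 1/t back to 1 - t. *)
have S2E : Zp_congr p S2 (t ^+ p.-1./2 *
    (gbinom_sum p (- (7%:R / 12%:R)) (- (11%:R / 12%:R)) (1 - t) * t)).
  rewrite /S2 -/(gbinom_sum p _ _ _) gbinom_sumC Zp_residue_sub //.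
  have := pfaff_congr p_pr (frac_int 7) (frac_int 1) pu u0.
  have -> : - 1 - - (1%:R / 12%:R) = - (11%:R / 12%:R) :> rat by lra.
  have -> : 1 - 1 / (1 / t) = 1 - t by rewrite !div1r invrK.
  rewrite -(expr_mul_inv _ (Zp_residue p (- (7%:R / 12%:R)))) //.
  by apply/Zp_congrM/Zp_congrX/Zp_congr_refl.
apply: Zp_congr_trans S2E _; apply: Zp_congrM.
  apply: Zp_legendre_symbol_euler => //.
  by rewrite -[odd p]negbK -dvdn2 dvdn_prime2 // neq_ltn (ltn_trans _ p3).
have [q [-> ltqp pq]] := mod4_3_coprime12 p12 p4.
(* The even part of [P * 'X] is the odd part of P times ['X], which accounts for the spare t. *)
rewrite even_polyMX hornerM hornerX; apply: Zp_congrM (Zp_congr_refl pt).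
case: pq => pE.
  apply: odd_legendre_congr; rewrite ?(ltnW p3) //.
  by apply: (frac 7); rewrite -pE.
rewrite gbinom_sumC.
apply: odd_legendre_congr; rewrite ?(ltnW p3) //.
by apply: (frac 11); rewrite -pE.
Qed.
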